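(* Let $N\ge 1$, let $\phi$ be a strictly positive unital functional on $\mathcal{P}_N^0=\mathbb{C}\langle Y_1,\ldots,Y_N\rangle$, and let $\{\varphi_\sigma\}_{\sigma\in\mathbb{F}_N^+}$ be the orthogonal polynomials associated to $\phi$. For $n\ge 0$ let $\Phi_n=[\varphi_\sigma]_{|\sigma|=n}$ be the row vector of the $\varphi_\sigma$ with $|\sigma|=n$, listed in lexicographic order. Then there exist complex matrices $A_{n,k}$ of size $N^n\times N^n$ and $B_{n,k}$ of size $N^{n+1}\times N^n$ ($n\ge 0$, $k=1,\ldots,N$) such that for $k=1,\ldots,N$, $$Y_k\Phi_0=\Phi_1B_{0,k}+\Phi_0A_{0,k},$$ and for $k=1,\ldots,N$ and $n\ge 1$, $$Y_k\Phi_n=\Phi_{n+1}B_{n,k}+\Phi_nA_{n,k}+\Phi_{n-1}B_{n-1,k}^*.$$ Here $Y_k\Phi_n=[Y_k\varphi_\sigma]_{|\sigma|=n}$ and $B^*$ denotes the conjugate transpose of $B$.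
   Context: $\mathbb{F}_N^+$ is the unital free semigroup (set of words) on $N$ letters $1,\ldots,N$, with empty word $\emptyset$ and length $|\sigma|$. It is totally ordered by $\preceq$: shorter words come first, and words of equal length are compared lexicographically. $\mathcal{P}_N^0$ is the algebra of polynomials with complex coefficients in non-commuting indeterminates $Y_1,\ldots,Y_N$. For $\sigma=i_1\cdots i_k$ put $Y_\sigma=Y_{i_1}\cdots Y_{i_k}$, $Y_\emptyset=1$. Let $\mathcal{I}$ be the conjugate-linear involution on $\mathcal{P}_N^0$ with $\mathcal{I}(Y_{i_1}\cdots Y_{i_k})=Y_{i_k}\cdots Y_{i_1}$. (This $*$-algebra is the quotient of the free $*$-algebra on $Y_1,\ldots,Y_N$ by the relations $Y_k=\mathcal{I}(Y_k)$.) A linear functional $\phi:\mathcal{P}_N^0\to\mathbb{C}$ is strictly positive and unital if $\phi(1)=1$ and $\phi(\mathcal{I}(P)P)>0$ for all $P\ne 0$. Put $\langle P,Q\rangle_\phi=\phi(\mathcal{I}(Q)P)$, an inner product on $\mathcal{P}_N^0$, linear in the first variable. The orthogonal polynomials associated to $\phi$ are the unique elements $\varphi_\sigma=\sum_{\tau\preceq\sigma}a_{\sigma,\tau}Y_\tau$, $\sigma\in\mathbb{F}_N^+$, with $a_{\sigma,\sigma}>0$ and $\langle\varphi_\sigma,\varphi_\tau\rangle_\phi=\delta_{\sigma,\tau}$ (obtained by the Gram–Schmidt procedure from $\{Y_\sigma\}$ in the order $\preceq$). *)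

(* Defs.v *)
(* Complex numbers are [R[i]] over a [realType]; polynomials in non-commuting
   indeterminates form the monoid algebra of the free monoid [{fmonom 'I_N}]. *)
From HB Require Import structures.
From mathcomp Require Export all_boot all_order all_algebra.
From mathcomp Require Export finmap complex reals.
From mathcomp.multinomials Require Export monalg.

Set Implicit Arguments.
Unset Strict Implicit.
Unset Printing Implicit Defensive.

Import Order.TTheory GRing.Theory Num.Theory.
Local Open Scope ring_scope.

Notation ncpoly R N := {malg R[i][{fmonom 'I_N}]} (only parsing).

(* Letters are numbered from 0 instead of 1. *)
Definition indet (R : realType) (N : nat) (k : 'I_N) : ncpoly R N := << fmu k >>.

(* Shorter words first; [seqlexi] compares words of equal length
   lexicographically. *)
Definition word_le (N : nat) (s t : {fmonom 'I_N}) : bool :=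
  (size s < size t)%N
  || (size s == size t) && ((s : seqlexi 'I_N) <= (t : seqlexi 'I_N))%O.

Lemma card_words (N n : nat) : #|{: n.-tuplelexi 'I_N}| = (N ^ n)%N.
Proof. by rewrite -[in RHS](card_ord N) -card_tuple. Qed.

(* The [i]-th word of length [n] in lexicographic order: [Order.enum_val] lists
   a finite ordered type increasingly. *)
Definition lex_word (N n : nat) (i : 'I_(N ^ n)) : {fmonom 'I_N} :=
  FMonom (tval
    (Order.enum_val (cast_ord (esym (card_words N n)) i) : n.-tuplelexi 'I_N)).

(* The conjugate-linear involution reversing words. *)
Definition ncstar (R : realType) (N : nat) (P : ncpoly R N) : ncpoly R N :=
  \sum_(s <- msupp P) << (P@_s)^* *g FMonom (rev s) >>.

Definition strictly_positive_unital (R : realType) (N : nat)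
    (phi : {scalar ncpoly R N}) : Prop :=
  phi 1 = 1 /\ forall P : ncpoly R N, P != 0 -> 0 < phi (ncstar P * P).

Definition ncdot (R : realType) (N : nat) (phi : {scalar ncpoly R N})
    (P Q : ncpoly R N) : R[i] :=
  phi (ncstar Q * P).

(* On [R[i]], [0 < a] means that [a] is real and positive. *)
Definition orthogonal_polynomials (R : realType) (N : nat)
    (phi : {scalar ncpoly R N}) (p : {fmonom 'I_N} -> ncpoly R N) : Prop :=
  [/\ forall s t, t \in msupp (p s) -> word_le t s,
      forall s, 0 < (p s)@_s
    & forall s t, ncdot phi (p s) (p t) = (s == t)%:R].

Definition orth_row (R : realType) (N : nat)
    (p : {fmonom 'I_N} -> ncpoly R N) (n : nat) : 'rV[ncpoly R N]_(N ^ n) :=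
  \row_i p (lex_word i).

(* A complex matrix seen as a matrix of constant polynomials, so that it can
   multiply [orth_row p n]. *)
Definition const_poly_mx (R : realType) (N m n : nat) (M : 'M[R[i]]_(m, n)) :
    'M[ncpoly R N]_(m, n) :=
  map_mx (in_alg (ncpoly R N)) M.

(* Main.v *)
(** Multiplication by [Y_k] is symmetric for [<., .>_phi] and raises degrees by
    at most one. Since the orthogonal polynomials of degree at most [d] span all
    polynomials of degree at most [d], expanding [Y_k phi_s] gives coefficients
    [<Y_k phi_s, phi_t> = <phi_s, Y_k phi_t>], which vanish unless the lengths of
    [s] and [t] differ by at most one. Conjugate symmetry of the coefficients
    follows by expanding [Y_k phi_t] in the second argument. *)
Require Import Defs.

Set Implicit Arguments.
Unset Strict Implicit.
Unset Printing Implicit Defensive.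

Import Order.TTheory GRing.Theory Num.Theory.
Local Open Scope ring_scope.
Local Open Scope sesquilinear_scope.

(** * The graded lexicographic order on words *)

Lemma word_le_size (N : nat) (s t : {fmonom 'I_N}) :
  word_le s t -> (size s <= size t)%N.
Proof. by case/orP=> [/ltnW //|/andP[/eqP-> _]]. Qed.

Lemma word_le_anti (N : nat) : antisymmetric (@word_le N).
Proof.
move=> s t /andP[/[dup] /word_le_size st hst /[dup] /word_le_size ts hts].
have e : size s = size t by apply/eqP; rewrite eqn_leq st ts.
move: hst hts; rewrite /word_le e ltnn eqxx /= => hst hts.
by apply: val_inj; apply: (@le_anti _ (seqlexi 'I_N)); rewrite hst hts.
Qed.

Lemma word_le_trans (N : nat) : transitive (@word_le N).
Proof.
move=> t s u /orP[st|/andP[/eqP st lst]] /orP[tu|/andP[/eqP tu ltu]].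
- by rewrite /word_le (ltn_trans st tu).
- by rewrite /word_le -tu st.
- by rewrite /word_le st tu.
- by rewrite /word_le st tu eqxx (le_trans lst ltu) orbT.
Qed.

Lemma word_le_total (N : nat) : total (@word_le N).
Proof.
move=> s t; rewrite /word_le; case: (ltngtP (size s) (size t)) => //= _.
exact: le_total.
Qed.

(** * Enumeration of words by length *)

Lemma size_lex_word (N n : nat) (i : 'I_(N ^ n)) : size (lex_word i) = n.
Proof. by rewrite /= size_tuple. Qed.

Lemma lex_word_inj (N n : nat) : injective (@lex_word N n).
Proof.
move=> i j [] /val_inj e; apply: (@cast_ord_inj _ _ (esym (card_words N n))).
exact: (@Order.enum_val_inj _ (n.-tuplelexi 'I_N) _ _ _ e).
Qed.

Lemma lex_word_surj (N n : nat) (s : {fmonom 'I_N}) :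
  size s = n -> exists i : 'I_(N ^ n), s = lex_word i.
Proof.
case: s => s /= /eqP hs.
exists (cast_ord (card_words N n)
         (Order.enum_rank (Tuple hs : n.-tuplelexi 'I_N))).
by rewrite /lex_word cast_ordK Order.enum_rankK.
Qed.

(** Grouping the words by length lets a sum over them split into one block per row
    [orth_row p m]. *)
Definition words_below (N d : nat) : seq {fmonom 'I_N} :=
  [seq lex_word i | m <- index_iota 0 d, i <- enum 'I_(N ^ m)].

Lemma mem_words_below (N d : nat) (s : {fmonom 'I_N}) :
  (s \in words_below N d) = (size s < d)%N.
Proof.
apply/allpairsPdep/idP=> [[m [i [hm _ ->]]]|hs].
  by move: hm; rewrite size_lex_word mem_index_iota.
have [i si] := lex_word_surj (erefl (size s)).
by exists (size s), i; rewrite mem_index_iota mem_enum.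
Qed.

Lemma words_below_uniq (N d : nat) : uniq (words_below N d).
Proof.
apply: allpairs_uniq_dep => [|m _|[m i] [m' j] _ _ /= e].
- exact: iota_uniq.
- exact: enum_uniq.
have em : m = m' by rewrite -(size_lex_word i) -(size_lex_word j) e.
by case: m' / em j e => j /lex_word_inj->.
Qed.

Lemma big_words_below (N d : nat) (V : zmodType) (F : {fmonom 'I_N} -> V) :
  \sum_(s <- words_below N d) F s =
  \sum_(m < d) \sum_(i < N ^ m) F (lex_word i).
Proof.
rewrite big_allpairs_dep big_mkord.
by apply: eq_bigr => m _; rewrite big_enum.
Qed.

(** * Scalars and triangular families in the monoid algebra *)

(* [{malg R[K]}] is only declared as an [lalgType] for non-commutative [K]. *)
Lemma malg_scalerAr (K : monomType) (R : comNzRingType) (c : R)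
  (f g : {malg R[K]}) : f * (c *: g) = c *: (f * g).
Proof.
rewrite -!mul_malgC !mulrA; congr (_ * g).
rewrite !malgM_def fgmulgU fgmulUg; apply: eq_bigr => k _.
by rewrite mulm1 mul1m mulrC.
Qed.

(* Gram-Schmidt inversion: [W] lists an initial segment of the words in
   decreasing order, so subtracting the right multiple of [p (head W)] removes
   the leading word of [P]. *)
Lemma span_triangular (N : nat) (F : fieldType)
    (p : {fmonom 'I_N} -> {malg F[{fmonom 'I_N}]})
    (p_lead : forall s t, t \in msupp (p s) -> word_le t s)
    (p_neq0 : forall s, (p s)@_s != 0)
    (W : seq {fmonom 'I_N}) (P : {malg F[{fmonom 'I_N}]}) :
    sorted (fun s t => word_le t s) W -> uniq W ->
    (forall s t, s \in W -> word_le t s -> t \in W) ->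
    {subset msupp P <= W} ->
  exists c : {fmonom 'I_N} -> F, P = \sum_(s <- W) c s *: p s.
Proof.
elim: W P => [|s W IHW] P /= sW uW dW PW.
  exists (fun=> 0); rewrite big_nil; apply/malgP=> t; rewrite mcoeff0.
  by apply/mcoeff_outdom/negP=> /PW.
have /andP[sNW uW'] := uW.
have leW : {in W, forall t, word_le t s}.
  apply/allP/(order_path_min _ sW) => x y z xy yz.
  exact: word_le_trans yz xy.
pose c0 := P@_s / (p s)@_s.
have [||||c Pc] := IHW (P - c0 *: p s).
- exact: path_sorted sW.
- exact: uW'.
(* The tail stays closed downwards: if [u] were [s], then [s] would precede [t], while sortedness
   puts [t] below [s]; so [t = s], against uniqueness. *)
- move=> t u tW ut; have := dW t u; rewrite !inE tW orbT => /(_ isT ut).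
  case/predU1P=> // us; move: sNW; rewrite -(_ : t = s) ?tW //.
  by apply: word_le_anti; rewrite leW // -us.
(* The choice of [c0] cancels the coefficient at [s]; a word outside [s :: W] lies in neither
   support, by downward closure. *)
- move=> t; rewrite -mcoeff_neq0 mcoeffB mcoeffZ; apply: contraNT => tW.
  have [->|ts] := eqVneq t s.
    by rewrite divfK ?subrr.
  have tsW : t \notin s :: W by rewrite inE negb_or ts.
  rewrite (mcoeff_outdom (contra (PW t) tsW)).
  rewrite [_@_t]mcoeff_outdom ?mulr0 ?subrr //.
  by apply: contra tsW => /p_lead; apply: dW; rewrite inE eqxx.
have PE : P = c0 *: p s + \sum_(t <- W) c t *: p t by rewrite -Pc addrC subrK.
have cE : \sum_(t <- W) (if t == s then c0 else c t) *: p t =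
          \sum_(t <- W) c t *: p t.
  by apply: eq_big_seq => t /(memPn sNW)/negPf ts; rewrite ts.
exists (fun t => if t == s then c0 else c t).
rewrite big_cons eqxx cE; exact: PE.
Qed.

(** Pairing with one member of an orthonormal family reads off its coefficient. The twist [nu]
    covers both arguments of the inner product: the identity for the first, conjugation for the
    second. *)
Lemma semilinear_delta_sum (I : eqType) (F : pzRingType) (V : lmodType F)
    (nu : F -> F) (f : V -> F) (e : I -> V) (s : I) :
    f 0 = 0 -> {morph f : x y / x + y} ->
    (forall a x, f (a *: x) = nu a * f x) ->
    (forall t, f (e t) = (t == s)%:R) ->
  forall (W : seq I) (c : I -> F), uniq W ->
  f (\sum_(t <- W) c t *: e t) = if s \in W then nu (c s) else 0.
Proof.
move=> f0 fD fZ fe W c uW; rewrite (big_morph f fD f0).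
under eq_bigr do rewrite fZ fe.
have [sW|sW] := boolP (s \in W).
  rewrite (bigD1_seq s) //= eqxx mulr1 big1 ?addr0 // => t /negPf->.
  by rewrite mulr0.
rewrite big_seq big1 // => t tW.
by rewrite (negPf (memPn sW t tW)) mulr0.
Qed.

(** * The involution and the sesquilinear form *)

Section InnerProduct.
Variables (R : realType) (N : nat).
Implicit Types (P Q : ncpoly R N) (s t : {fmonom 'I_N}).

(** Reversal is a bijection of words, so at most one term of the sum contributes to each
    coefficient. *)
Lemma mcoeff_ncstar P s : (ncstar P)@_s = (P@_(FMonom (rev s)))^*.
Proof.
rewrite /ncstar raddf_sum /=.
have revE t : (FMonom (rev t) == s) = (t == FMonom (rev s)).
  by rewrite !fmP /=; apply/eqP/eqP=> [<-|->]; rewrite revK.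
under eq_bigr do rewrite mcoeffU revE.
have [sP|sP] := boolP (FMonom (rev s) \in msupp P).
  rewrite (big_fsetD1 _ sP) /= eqxx big1_fset ?addr0 // => t.
  by rewrite !inE => /andP[/negPf->].
rewrite mcoeff_outdom // conjC0 big1_fset // => t tP _.
by case: eqP => // e; rewrite e (negPf sP) in tP.
Qed.

Lemma ncstarD : {morph @ncstar R N : P Q / P + Q}.
Proof.
move=> P Q; apply/malgP=> s; rewrite mcoeff_ncstar !mcoeffD.
apply: (etrans (rmorphD (@Num.conj R[i]) _ _)).
by congr (_ + _); apply: esym; apply: mcoeff_ncstar.
Qed.

Lemma ncstarZ (c : R[i]) P : ncstar (c *: P) = c^* *: ncstar P.
Proof.
apply/malgP=> s; rewrite mcoeff_ncstar !mcoeffZ [(ncstar P)@_s]mcoeff_ncstar.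
exact: (rmorphM (@Num.conj R[i])).
Qed.

Lemma ncstar0 : ncstar (0 : ncpoly R N) = 0.
Proof. by apply/malgP=> s; rewrite mcoeff_ncstar !mcoeff0 conjC0. Qed.

Lemma ncstarU (c : R[i]) s : ncstar << c *g s >> = << c^* *g FMonom (rev s) >>.
Proof.
apply/malgP=> t; rewrite mcoeff_ncstar !mcoeffU rmorphMn /=.
by rewrite !fmP /= -(inj_eq (can_inj (@revK _))) revK.
Qed.

(** By additivity it suffices to treat monomials, where reversing a word moves its first letter to
    the end. *)
Lemma ncstar_indetM (k : 'I_N) P : ncstar (indet R k * P) = ncstar P * indet R k.
Proof.
rewrite (monalgE P) mulr_sumr !(big_morph _ ncstarD ncstar0) mulr_suml.
apply: eq_bigr => s _; rewrite /indet !ncstarU !malgM_def !fgmulUU !ncstarU.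
rewrite mul1r mulr1; congr << _ *g _ >>.
by rewrite /mmul /= !fmmulE fmuE /= rev_cons cats1.
Qed.

Variable phi : {scalar ncpoly R N}.

Lemma ncdotZl (c : R[i]) P Q : ncdot phi (c *: P) Q = c * ncdot phi P Q.
Proof. by rewrite /ncdot malg_scalerAr linearZ. Qed.

Lemma ncdotDl Q : {morph (ncdot phi)^~ Q : P P' / P + P'}.
Proof. by move=> P P'; rewrite /ncdot mulrDr linearD. Qed.

Lemma ncdot0l Q : ncdot phi 0 Q = 0.
Proof. by rewrite /ncdot mulr0 linear0. Qed.

Lemma ncdotZr (c : R[i]) P Q : ncdot phi P (c *: Q) = c^* * ncdot phi P Q.
Proof. by rewrite /ncdot ncstarZ -scalerAl linearZ. Qed.

Lemma ncdotDr P : {morph ncdot phi P : Q Q' / Q + Q'}.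
Proof. by move=> Q Q'; rewrite /ncdot ncstarD mulrDl linearD. Qed.

Lemma ncdot0r P : ncdot phi P 0 = 0.
Proof. by rewrite /ncdot ncstar0 mul0r linear0. Qed.

Lemma ncdot_indetM (k : 'I_N) P Q :
  ncdot phi (indet R k * P) Q = ncdot phi P (indet R k * Q).
Proof. by rewrite /ncdot ncstar_indetM mulrA. Qed.

(** * Expansion in orthogonal polynomials *)

Variable p : {fmonom 'I_N} -> ncpoly R N.
Hypothesis hp : orthogonal_polynomials phi p.

Lemma orthogonal_expansion (d : nat) P :
    {in msupp P, forall s, (size s < d)%N} ->
  P = \sum_(s <- words_below N d) ncdot phi P (p s) *: p s.
Proof.
move=> Pd; have [p_lead p_pos p_orth] := hp.
have p_neq0 s : (p s)@_s != 0 by rewrite gt_eqF ?p_pos.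
(* The words are put in decreasing order, as [span_triangular] requires. *)
pose W := sort (fun s t => word_le t s) (words_below N d).
have pW : perm_eq W (words_below N d) by rewrite perm_sort.
have uW : uniq W by rewrite (perm_uniq pW) words_below_uniq.
have memW s : (s \in W) = (size s < d)%N.
  by rewrite (perm_mem pW) mem_words_below.
have [||||c Pc] := @span_triangular N _ p p_lead p_neq0 W P.
- by apply: sort_sorted => s t; apply: word_le_total.
- exact: uW.
- by move=> s t; rewrite !memW => sd /word_le_size ts; apply: leq_ltn_trans sd.
- by move=> s /Pd; rewrite memW.
(* Orthonormality identifies the coefficients, so far only known to exist. *)
have cE s : s \in W -> c s = ncdot phi P (p s).
  move=> sW; rewrite Pc.
  rewrite (@semilinear_delta_sum _ _ _ id ((ncdot phi)^~ (p s)) p s) ?sW //.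
  - exact: ncdot0l.
  - exact: ncdotDl.
  - by move=> a Q; apply: ncdotZl.
apply: (etrans Pc); rewrite -(perm_big _ pW).
by apply: eq_big_seq => s sW; rewrite cE.
Qed.

Lemma msupp_orthogonal s : {in msupp (p s), forall t, (size t <= size s)%N}.
Proof. by have [p_lead _ _] := hp; move=> t /p_lead /word_le_size. Qed.

Lemma msupp_indetM (k : 'I_N) s :
  {in msupp (indet R k * p s), forall t, (size t < (size s).+2)%N}.
Proof.
move=> t /msuppM_le[u [v [uk /msupp_orthogonal vs ->]]].
move: uk; rewrite msuppU1 inE => /eqP->.
by rewrite /mmul /= fmmulE fmuE /= !ltnS.
Qed.

(** Expanding [indet R k * p t] in the second argument conjugates its coefficients; the length bound
    ensures that [s] is among the words of the expansion. *)
Lemma ncdot_indetM_conj (k : 'I_N) s t : (size s <= (size t).+1)%N ->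
  ncdot phi (indet R k * p s) (p t) = (ncdot phi (indet R k * p t) (p s))^*.
Proof.
move=> st; have [_ _ p_orth] := hp; rewrite [LHS]ncdot_indetM.
rewrite {1}(orthogonal_expansion (@msupp_indetM k t)).
rewrite (@semilinear_delta_sum _ _ _ Num.conj (ncdot phi (p s)) p s).
- by rewrite mem_words_below ltnS st.
- exact: ncdot0r.
- exact: ncdotDr.
- by move=> a Q; apply: ncdotZr.
- by move=> u; rewrite p_orth eq_sym.
- exact: words_below_uniq.
Qed.

(** Here [s] is too long to occur in the expansion of [indet R k * p t]. *)
Lemma ncdot_indetM_eq0 (k : 'I_N) s t : ((size t).+1 < size s)%N ->
  ncdot phi (indet R k * p s) (p t) = 0.
Proof.
move=> ts; have [_ _ p_orth] := hp; rewrite [LHS]ncdot_indetM.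
rewrite (orthogonal_expansion (@msupp_indetM k t)).
rewrite (@semilinear_delta_sum _ _ _ Num.conj (ncdot phi (p s)) p s).
- by rewrite mem_words_below ltnNge ts.
- exact: ncdot0r.
- exact: ncdotDr.
- by move=> a Q; apply: ncdotZr.
- by move=> u; rewrite p_orth eq_sym.
- exact: words_below_uniq.
Qed.

(** The block, from degree [n] to degree [m], of the matrix of left multiplication by [indet R k] in
    the orthonormal basis. *)
Definition coeff_mx (k : 'I_N) (m n : nat) : 'M[R[i]]_(N ^ m, N ^ n) :=
  \matrix_(j, i) ncdot phi (indet R k * p (lex_word i)) (p (lex_word j)).

Lemma mulmx_orth_row (m n : nat) (M : 'M[R[i]]_(N ^ m, N ^ n)) i :
  (orth_row p m *m const_poly_mx N M) 0 i =
  \sum_j M j i *: p (lex_word j).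
Proof.
rewrite mxE; apply: eq_bigr => j _.
by rewrite !mxE malg_scalerAr mulr1.
Qed.

Lemma indet_orth_row (k : 'I_N) (n : nat) :
  \row_i (indet R k * orth_row p n 0 i) =
  \sum_(m < n.+2) orth_row p m *m const_poly_mx N (coeff_mx k m n).
Proof.
apply/rowP=> i; rewrite summxE !mxE.
rewrite [LHS](orthogonal_expansion (@msupp_indetM k _)) size_lex_word.
rewrite big_words_below; apply: eq_bigr => m _; rewrite mulmx_orth_row.
by apply: eq_bigr => j _; rewrite mxE.
Qed.

(** This symmetry of neighbouring blocks produces the conjugate transpose in the recurrence. *)
Lemma coeff_mx_conj (k : 'I_N) (n : nat) :
  coeff_mx k n n.+1 = (coeff_mx k n.+1 n)^t*.
Proof.
apply/matrixP=> j i; rewrite !mxE; apply: ncdot_indetM_conj.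
by rewrite !size_lex_word.
Qed.

Lemma coeff_mx_eq0 (k : 'I_N) (m n : nat) : (m.+1 < n)%N -> coeff_mx k m n = 0.
Proof.
move=> mn; apply/matrixP=> j i; rewrite !mxE; apply: ncdot_indetM_eq0.
by rewrite !size_lex_word.
Qed.

End InnerProduct.

Theorem theorem3 (R : realType) (N : nat) (hN : (1 <= N)%N)
    (phi : {scalar ncpoly R N}) (hphi : strictly_positive_unital phi)
    (p : {fmonom 'I_N} -> ncpoly R N) (hp : orthogonal_polynomials phi p) :
  exists (A : forall n : nat, 'I_N -> 'M[R[i]]_(N ^ n, N ^ n))
         (B : forall n : nat, 'I_N -> 'M[R[i]]_(N ^ n.+1, N ^ n)),
    (forall k : 'I_N,
      \row_i (indet R k * orth_row p 0 0 i) =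
        orth_row p 1 *m const_poly_mx N (B 0%N k)
        + orth_row p 0 *m const_poly_mx N (A 0%N k)) /\
    (forall (k : 'I_N) (n : nat),
      \row_i (indet R k * orth_row p n.+1 0 i) =
        orth_row p n.+2 *m const_poly_mx N (B n.+1 k)
        + orth_row p n.+1 *m const_poly_mx N (A n.+1 k)
        + orth_row p n *m const_poly_mx N ((B n k)^t*)).
Proof.
(* [A] collects the diagonal blocks and [B] the blocks that raise the degree by one. *)
exists (fun n k => coeff_mx phi p k n n), (fun n k => coeff_mx phi p k n.+1 n).
split=> [k|k n]; rewrite (indet_orth_row hp) !big_ord_recr /=.
  by rewrite big_ord0 add0r addrC.
(* After the top three degrees are split off, the remaining [m < n] lie at least two below [n.+1],
   so their blocks vanish. *)
rewrite big1 ?add0r; last first.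
  by move=> m _; rewrite (coeff_mx_eq0 hp) ?ltnS // /const_poly_mx map_mx0 mulmx0.
by rewrite (coeff_mx_conj hp) addrC addrA addrAC.
Qed.
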